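(* Let $K\subseteq\mathbb R^d$ be a compact convex polytope, and let $(\Phi_{\omega_n})_{n\ge1}$ be i.i.d. random piecewise affine self-maps of $K$. Set $\Phi_n:=\Phi_{\omega_n}\circ\cdots\circ\Phi_{\omega_1}$, $R_n:=R_{\mathrm{cov}}(\Phi_n;K)$ and $Y_n:=n^{-1}\log R_n$. Assume that $R_n$ is measurable for every $n\ge1$, and that $\sup_{\omega}R_{\mathrm{cov}}(\Phi_{\omega};K)\le B$ for some deterministic $B\ge1$. Then for every $q\in\mathbb R$ the limit $$\Lambda_{\mathrm{cov}}(q):=\lim_{n\to\infty} n^{-1}\log\mathbb E[R_n^q]$$ exists. For $q\ge0$ one has $\Lambda_{\mathrm{cov}}(q)=\inf_{n\ge1} n^{-1}\log\mathbb E[R_n^q]$, while for $q<0$ one has $\Lambda_{\mathrm{cov}}(q)=\sup_{n\ge1} n^{-1}\log\mathbb E[R_n^q]$. Moreover, $\Lambda_{\mathrm{cov}}$ is finite and convex on $\mathbb R$, and $\min\{0,q\log B\}\le \Lambda_{\mathrm{cov}}(q)\le \max\{0,q\log B\}$ for all $q\in\mathbb R$. If $I_{\mathrm{cov},+}(x):=\sup_{q\ge0}\{qx-\Lambda_{\mathrm{cov}}(q)\}$ and $I_{\mathrm{cov},-}(x):=\sup_{q\le0}\{qx-\Lambda_{\mathrm{cov}}(q)\}$, then, for every $x\in\mathbb R$, $$\limsup_{n\to\infty} n^{-1}\log\mathbb P(Y_n\ge x)\le -I_{\mathrm{cov},+}(x) \qquad\text{and}\qquad \limsup_{n\to\infty}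 n^{-1}\log\mathbb P(Y_n\le x)\le -I_{\mathrm{cov},-}(x).$$
   Context: A map is affine on a subset of $K$ if it agrees there with the restriction of an affine map on $\mathbb R^d$. For a map $f:K\to K$, $R_{\mathrm{cov}}(f;K)$ denotes the smallest integer $M\ge1$ for which there exist compact convex polytopes $P_1,\dots,P_M\subseteq K$ whose union is $K$ and such that $f$ is affine on each $P_i$. A map $f:K\to K$ is called piecewise affine if such a finite convex-polytopal affine cover exists. The random maps are given by i.i.d. random parameters $\omega_1,\omega_2,\dots$ and a family $(\Phi_\omega)_\omega$ of piecewise affine self-maps of $K$ indexed by the parameter space; $\sup_\omega$ is over the parameter space. Conventions: $\log 0=-\infty$; rate functions may take the value $+\infty$. *)

(* Defs.v *)
From HB Require Import structures.
From mathcomp Require Import all_boot all_order all_algebra finmap.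
From mathcomp Require Import all_classical all_reals all_analysis.

Set Implicit Arguments.
Unset Strict Implicit.
Unset Printing Implicit Defensive.

Import Order.TTheory GRing.Theory Num.Theory.
Import numFieldNormedType.Exports.

Local Open Scope classical_set_scope.
Local Open Scope ring_scope.

Section PiecewiseAffine.
Context {R : realType} {d : nat}.
Implicit Types (K P : set 'rV[R]_d) (f : 'rV[R]_d -> 'rV[R]_d).

(* A pair h stands for the closed half-space <h.1, x> <= h.2. A polytope is a
   compact finite intersection of closed half-spaces; the empty set is one. *)
Definition half_space (h : 'rV[R]_d * R) : set 'rV[R]_d :=
  [set x | \sum_(i < d) h.1 0 i * x 0 i <= h.2].

Definition compact_convex_polytope P : Prop :=
  compact P /\
  exists hs : seq ('rV[R]_d * R), P = \bigcap_(h in [set` hs]) half_space h.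

Definition affine_on (S : set 'rV[R]_d) f : Prop :=
  exists (A : 'M[R]_d) (b : 'rV[R]_d), forall x, S x -> f x = x *m A + b.

Definition affine_cover K f (M : nat) : Prop :=
  exists P : 'I_M -> set 'rV[R]_d,
    [/\ forall i, compact_convex_polytope (P i),
        forall i, P i `<=` K,
        \bigcup_i P i = K &
        forall i, affine_on (P i) f].

(* Self-maps of K are total maps on R^d sending K to K; their values outside K
   play no role. *)
Definition piecewise_affine K f : Prop :=
  set_fun K K f /\ exists M, affine_cover K f M.

(* The value is 0 when no finite affine cover exists. *)
Definition Rcov K f : nat :=
  xget 0%N [set M | [/\ (1 <= M)%N, affine_cover K f M &
    forall M', (1 <= M')%N -> affine_cover K f M' -> (M <= M')%N]].

End PiecewiseAffine.

Section IID.
Context {dT dE : measure_display} {T : measurableType dT}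
  {E : measurableType dE} {R : realType} (P : probability T R).

Definition mutually_independent (X : nat -> {RV P >-> E}) : Prop :=
  forall (J : {fset nat}) (A : nat -> set E),
    (forall i, i \in J -> measurable (A i)) ->
    P (\bigcap_(i in [set` J]) (X i @^-1` A i)) =
    (\prod_(i <- J) P (X i @^-1` A i))%E.

Definition identically_distributed (X : nat -> {RV P >-> E}) : Prop :=
  forall i (A : set E), measurable A ->
    distribution P (X i) A = distribution P (X 0%N) A.

Definition iid (X : nat -> {RV P >-> E}) : Prop :=
  mutually_independent X /\ identically_distributed X.

End IID.

Section RandomComposition.
Context {R : realType} {d : nat} {dE : measure_display}
  {E : measurableType dE}.
Variables (K : set 'rV[R]_d) (Phi : E -> 'rV[R]_d -> 'rV[R]_d).

(* For s = [:: e_1; ...; e_n] this is Phi e_n \o ... \o Phi e_1. *)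
Definition compose_params (s : seq E) (x : 'rV[R]_d) : 'rV[R]_d :=
  foldl (fun y e => Phi e y) x s.

(* R_n as a function of the n parameters. Measurability of R_n refers to this
   function, for the product sigma-algebra on parameter n-tuples, so that
   Rparam evaluated at a shifted block of parameters is again a random variable,
   with the law of R_n. *)
Definition Rparam (n : nat) (s : n.-tuple E) : nat :=
  Rcov K (compose_params s).

Context {dT : measure_display} {T : measurableType dT}
  (P : probability T R).
(* X i is the parameter omega_(i+1). *)
Variable X : nat -> {RV P >-> E}.

Definition Rn (n : nat) (w : T) : nat := Rparam [tuple X i w | i < n].

Definition Yn (n : nat) (w : T) : R := n%:R^-1 * ln (Rn n w)%:R.

Definition log_moment (q : R) (n : nat) : \bar R :=
  ((n%:R^-1)%:E * lne 'E_P[(fun w => ((Rn n w)%:R : R) `^ q)%R])%E.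

Definition Lambda_cov (q : R) : \bar R := limn (log_moment q).

Definition I_cov_plus (x : R) : \bar R :=
  ereal_sup [set ((q * x)%:E - Lambda_cov q)%E | q in [set q : R | 0 <= q]].

Definition I_cov_minus (x : R) : \bar R :=
  ereal_sup [set ((q * x)%:E - Lambda_cov q)%E | q in [set q : R | q <= 0]].

End RandomComposition.

(* Main.v *)
(* Intersecting the pieces of a cover for f with the f-preimages of the pieces
   of a cover for g yields a cover for g \o f, so Rcov is submultiplicative under
   composition and R_(n+m) <= R_n * R'_m, where R'_m is the complexity of the
   parameter block n+1, ..., n+m. Since R'_m is independent of R_n and has the
   law of R_m, log E[R_n^q] is subadditive for q >= 0 and superadditive for
   q <= 0, and Fekete's lemma gives the limit. The bounds come from
   1 <= R_n <= B^n, convexity from Hölder's inequality at each n, and the tail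
   estimates from Markov's inequality applied to R_n^q. *)

Require Import Defs.
From HB Require Import structures.
From mathcomp Require Import all_boot all_order all_algebra finmap.
From mathcomp Require Import all_classical all_reals all_analysis.
From mathcomp Require Import measurable_realfun lra ring.

Import Order.TTheory GRing.Theory Num.Theory.
Import numFieldNormedType.Exports.

Local Open Scope classical_set_scope.
Local Open Scope ring_scope.

Set Implicit Arguments.
Unset Strict Implicit.
Unset Printing Implicit Defensive.

(** * Submultiplicativity of the covering number *)

Lemma continuous_sum_coords (R : realType) (d : nat) (c : 'rV[R]_d) :
  continuous (fun x : 'rV[R]_d => \sum_(i < d) c 0 i * x 0 i : R).
Proof.
apply: (@continuous_big R^o _ +%R) => [|i _ x]; first exact: add_continuous.
by apply: continuousM; [exact: cst_continuous|exact: coord_continuous].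
Qed.

Lemma closed_half_space (R : realType) (d : nat) (h : 'rV[R]_d * R) :
  closed (half_space h).
Proof.
rewrite (_ : half_space h =
  (fun x : 'rV[R]_d => \sum_(i < d) h.1 0 i * x 0 i : R) @^-1` [set y | y <= h.2]) //.
by apply: preimage_closed => [x _|]; [exact: continuous_sum_coords|exact: closed_le].
Qed.

(** Moving [A] across the pairing gives [<h.1, x A + b> = <h.1 A^T, x> + <h.1, b>], so one affine
    inequality pulls back to one. *)
Lemma half_space_affine (R : realType) (d : nat) (h : 'rV[R]_d * R)
    (A : 'M[R]_d) (b x : 'rV[R]_d) :
  half_space h (x *m A + b) <->
  half_space (h.1 *m A^T, h.2 - \sum_(i < d) h.1 0 i * b 0 i) x.
Proof.
rewrite /half_space /= lerBrDr.
suff -> : \sum_(i < d) h.1 0 i * (x *m A + b) 0 i =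
  \sum_(i < d) (h.1 *m A^T) 0 i * x 0 i + \sum_(i < d) h.1 0 i * b 0 i by [].
under eq_bigr => i _ do rewrite mxE mulrDr.
rewrite big_split /=; congr +%R.
under eq_bigr => i _ do rewrite mxE mulr_sumr.
under [RHS]eq_bigr => i _ do rewrite mxE mulr_suml.
rewrite exchange_big; apply: eq_bigr => i _; apply: eq_bigr => j _ /=.
by rewrite mxE mulrA mulrAC.
Qed.

(** On [P] the map [f] is affine, so the pulled-back inequalities of [Q] join those of [P];
    compactness is inherited from [P] because half-spaces are closed. *)
Lemma polytope_preimage (R : realType) (d : nat) (P Q : set 'rV[R]_d)
    (f : 'rV[R]_d -> 'rV[R]_d) :
  compact_convex_polytope P -> compact_convex_polytope Q -> affine_on P f ->
  compact_convex_polytope (P `&` f @^-1` Q).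
Proof.
move=> [cP [hP PE]] [_ [hQ QE]] [A [b fE]].
pose pull (h : 'rV[R]_d * R) :=
  (h.1 *m A^T, h.2 - \sum_(i < d) h.1 0 i * b 0 i).
have QpE : P `&` f @^-1` Q =
    P `&` \bigcap_(h in [set` map pull hQ]) half_space h.
  apply/seteqP; split=> x /= [Px Qx]; split => //.
    move=> _ /= /mapP[h hh ->]; apply/half_space_affine; rewrite -fE//.
    by move: Qx; rewrite QE; exact.
  rewrite QE => h /= hh; rewrite fE//; apply/half_space_affine.
  by apply: Qx => /=; exact: map_f.
split.
  rewrite QpE; apply: compact_closedI => //.
  by apply: closed_bigI => h _; exact: closed_half_space.
exists (hP ++ map pull hQ); rewrite QpE PE.
apply/seteqP; split=> [x [Px Qx] h /=|x H].
  by rewrite mem_cat => /orP[]; [exact: Px|exact: Qx].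
by split=> h hh; apply: H; rewrite /= mem_cat hh ?orbT.
Qed.

Lemma affine_on_comp (R : realType) (d : nat) (P Q : set 'rV[R]_d)
    (f g : 'rV[R]_d -> 'rV[R]_d) :
  affine_on P f -> affine_on Q g -> affine_on (P `&` f @^-1` Q) (g \o f).
Proof.
move=> [A [b fE]] [A' [b' gE]]; exists (A *m A'), (b *m A' + b') => x [Px Qx] /=.
by rewrite gE // fE // mulmxDl mulmxA addrA.
Qed.

(** Pieces are indexed by pairs [(i, j)]: on the part of [P i] that [f] sends into [Q j], the
    composite is affine. Empty pieces may occur and are polytopes too. *)
Lemma affine_cover_comp (R : realType) (d : nat) (K : set 'rV[R]_d)
    (f g : 'rV[R]_d -> 'rV[R]_d) (M N : nat) :
  set_fun K K f -> affine_cover K f M -> affine_cover K g N ->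
  affine_cover K (g \o f) (M * N)%N.
Proof.
move=> fK [P [cP PK PU Pf]] [Q [cQ QK QU Qg]].
have e : #|{: 'I_M * 'I_N}| = (M * N)%N by rewrite card_prod !card_ord.
(* An index below [M * N] is decoded into a pair by enumerating the product type. *)
pose ix (k : 'I_(M * N)) : 'I_M * 'I_N := enum_val (cast_ord (esym e) k).
exists (fun k => P (ix k).1 `&` f @^-1` Q (ix k).2); split=> [k|k x []|| k].
- exact: polytope_preimage.
- by move=> /PK.
- apply/seteqP; split=> [x [k _ [/PK]]//|x Kx].
  have : K x by [].
  rewrite -{1}PU => -[i _ Pix].
  have : K (f x) by exact: fK.
  rewrite -{1}QU => -[j _ Qjx].
  exists (cast_ord e (enum_rank (i, j))) => //.
  by rewrite /ix cast_ordK enum_rankK.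
- exact: affine_on_comp.
Qed.

(** * Minimal covers and their behaviour under composition *)

Section RcovTheory.
Context {R : realType} {d : nat} {K : set 'rV[R]_d}.
Hypothesis polyK : compact_convex_polytope K.
Implicit Types f g : 'rV[R]_d -> 'rV[R]_d.

(** A cover without pieces forces [K] to be empty; then [K] itself serves as a single piece, any map
    being affine on the empty set. *)
Lemma piecewise_affine_gt0 f : piecewise_affine K f ->
  exists2 M, (0 < M)%N & affine_cover K f M.
Proof.
move=> [_ [[|M] cov]]; last by exists M.+1.
have K0 x : ~ K x.
  by case: cov => P [_ _ <- _] [[]].
exists 1%N => //; exists (fun=> K); split=> [//|i x //||i].
  by apply/seteqP; split=> [x [i]//|x Kx]; exists ord0.
by exists 0, 0 => x /K0.
Qed.

(** A least positive cover size exists by well-ordering, so [Rcov] is this minimum and not the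
    default value 0. *)
Lemma RcovP f : piecewise_affine K f ->
  [/\ (1 <= Rcov K f)%N, affine_cover K f (Rcov K f) &
    forall M, (1 <= M)%N -> affine_cover K f M -> (Rcov K f <= M)%N].
Proof.
move=> /piecewise_affine_gt0[M M0 covM].
suff : exists M, [/\ (1 <= M)%N, affine_cover K f M &
    forall M', (1 <= M')%N -> affine_cover K f M' -> (M <= M')%N].
  exact: xgetPex.
have ex : exists M, (0 < M)%N && `[< affine_cover K f M >].
  by exists M; rewrite M0; exact/asboolP.
case: (ex_minnP ex) => m /andP[m0 /asboolP covm] mmin; exists m; split => //.
by move=> M' M'0 covM'; apply: mmin; rewrite M'0; exact/asboolP.
Qed.

Lemma piecewise_affine_comp f g : piecewise_affine K f -> piecewise_affine K g ->
  piecewise_affine K (g \o f).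
Proof.
move=> [fK [M covf]] [gK [N covg]]; split; first by move=> x /fK /gK.
by exists (M * N)%N; exact: affine_cover_comp.
Qed.

Lemma Rcov_comp f g : piecewise_affine K f -> piecewise_affine K g ->
  (Rcov K (g \o f) <= Rcov K f * Rcov K g)%N.
Proof.
move=> pf pg; have [f1 covf _] := RcovP pf; have [g1 covg _] := RcovP pg.
have [_ _] := RcovP (piecewise_affine_comp pf pg); apply.
  by rewrite muln_gt0 f1.
by case: pf => fK _; exact: affine_cover_comp.
Qed.

Lemma affine_cover_id : affine_cover K id 1.
Proof.
exists (fun=> K); split=> [//|i x //||i].
  by apply/seteqP; split=> [x [i]//|x Kx]; exists ord0.
by exists 1%:M, 0 => x _; rewrite mulmx1 addr0.
Qed.

Lemma piecewise_affine_id : piecewise_affine K id.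
Proof. by split=> //; exists 1%N; exact: affine_cover_id. Qed.

Lemma Rcov_id : Rcov K id = 1%N.
Proof.
have [R1 _ /(_ 1%N isT affine_cover_id) R1'] := RcovP piecewise_affine_id.
by apply/eqP; rewrite eqn_leq R1 R1'.
Qed.

Context {dE : measure_display} {E : measurableType dE}.
Context {Phi : E -> 'rV[R]_d -> 'rV[R]_d}.
Hypothesis PhiP : forall e, piecewise_affine K (Phi e).

Lemma compose_params_cat (s t : seq E) :
  compose_params Phi (s ++ t) = compose_params Phi t \o compose_params Phi s.
Proof. by apply/funext => x; rewrite /compose_params foldl_cat. Qed.

Lemma piecewise_affine_compose_params (s : seq E) :
  piecewise_affine K (compose_params Phi s).
Proof.
elim/last_ind: s => [|s e IH].
  by rewrite [compose_params _ _](_ : _ = id) //; exact: piecewise_affine_id.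
by rewrite -cats1 compose_params_cat; apply: piecewise_affine_comp => //; exact: PhiP.
Qed.

Lemma Rcov_compose_params_gt0 (s : seq E) :
  (0 < Rcov K (compose_params Phi s))%N.
Proof. by have [] := RcovP (piecewise_affine_compose_params s). Qed.

Lemma Rcov_compose_params_cat (s t : seq E) :
  (Rcov K (compose_params Phi (s ++ t)) <=
   Rcov K (compose_params Phi s) * Rcov K (compose_params Phi t))%N.
Proof.
by rewrite compose_params_cat; apply: Rcov_comp;
  exact: piecewise_affine_compose_params.
Qed.

(** Induction on the last map applied; the empty composition is the identity, whose covering number
    1 equals [B ^+ 0]. *)
Lemma Rcov_compose_params_le (B : R) (s : seq E) :
  1 <= B -> (forall e, (Rcov K (Phi e))%:R <= B) ->
  (Rcov K (compose_params Phi s))%:R <= B ^+ size s.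
Proof.
move=> B1 RB; elim/last_ind: s => [|s e IH].
  by rewrite [compose_params _ _](_ : _ = id)// Rcov_id expr0.
rewrite -cats1 size_cat addn1 exprSr.
apply: (@le_trans _ _ (Rcov K (compose_params Phi s) * Rcov K (Phi e))%N%:R).
  rewrite ler_nat; exact: (Rcov_compose_params_cat s [:: e]).
by rewrite natrM ler_pM.
Qed.

End RcovTheory.

(** * Independent blocks of parameters *)

Section TupleRectangles.
Context {dE : measure_display} {E : measurableType dE}.

(** The sides form a sequence over [nat] rather than over ['I_n], so that those of consecutive
    blocks can be shifted and joined. *)
Definition tuple_rectangle (n : nat) (F : nat -> set E) : set (n.-tuple E) :=
  [set t | forall i : 'I_n, F i (tnth t i)].

Definition tuple_rectangles (n : nat) : set (set (n.-tuple E)) :=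
  [set A | exists2 F : nat -> set E, (forall i, measurable (F i)) &
    A = tuple_rectangle F].

Lemma measurable_tuple_rectangle (n : nat) (F : nat -> set E) :
  (forall i, measurable (F i)) -> measurable (tuple_rectangle F : set (n.-tuple E)).
Proof.
move=> mF.
rewrite (_ : tuple_rectangle F =
    \bigcap_(i in [set: 'I_n]) ((fun t : n.-tuple E => tnth t i) @^-1` F i)).
  apply: fin_bigcap_measurable => // i _; rewrite -[X in measurable X]setTI.
  exact: measurable_tnth.
by apply/seteqP; split=> t /= Ft i; [move=> _; exact: Ft|exact: (Ft i I)].
Qed.

Lemma setI_closed_tuple_rectangles (n : nat) : setI_closed (@tuple_rectangles n).
Proof.
move=> _ _ [F mF ->] [G mG ->].
exists (fun i => F i `&` G i); first by move=> i; exact: measurableI.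
apply/seteqP; split=> t; first by move=> [Ft Gt] i; split.
by move=> FGt; split=> i; have [] := FGt i.
Qed.

(** The product sigma-algebra is generated by preimages of coordinates, each of which is a rectangle
    with all sides but one full. *)
Lemma measurable_tuple_rectangles (n : nat) :
  @measurable _ (n.-tuple E) `<=` <<s @tuple_rectangles n >>.
Proof.
apply: smallest_sub; first exact: smallest_sigma_algebra.
rewrite -bigcup_seq /=; apply: bigcup_sub => i _ _ [A mA <-].
apply: sub_sigma_algebra; exists (fun j : nat => if j == i :> nat then A else setT).
  by move=> j; case: ifP.
apply/seteqP; split=> t /=.
  by move=> [_ Ati] j; case: ifPn => // /eqP/val_inj ->.
by move=> /(_ i); rewrite eqxx.
Qed.

(** A pi-lambda argument: rectangles are stable under intersection, include the whole space and
    generate the sigma-algebra. *)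
Lemma tuple_measure_unique (R : realType) (n : nat)
    (m1 m2 : {measure set (n.-tuple E) -> \bar R}) :
  (m1 setT < +oo)%E ->
  (forall F, (forall i, measurable (F i)) ->
    m1 (tuple_rectangle F) = m2 (tuple_rectangle F)) ->
  forall A, measurable A -> m1 A = m2 A.
Proof.
move=> m1oo m12 A mA.
have rT : [set: n.-tuple E] = tuple_rectangle (fun=> [set: E]) by apply/seteqP; split.
apply: (@g_sigma_algebra_measure_unique _ _ _ (@tuple_rectangles n) _
  (fun=> setT)) => //.
- by move=> _ [F mF ->]; exact: measurable_tuple_rectangle.
- by move=> _; rewrite rT; exists (fun=> setT).
- by apply/seteqP; split=> // t _; exists 0%N.
- exact: setI_closed_tuple_rectangles.
- by move=> _ [F mF ->]; exact: m12.
- exact: measurable_tuple_rectangles.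
Qed.

End TupleRectangles.

Section IIDBlocks.
Context {dT dE : measure_display} {T : measurableType dT}
  {E : measurableType dE} {R : realType} {P : probability T R}.
Variable X : nat -> {RV P >-> E}.
Hypothesis iidX : iid X.

(** [block 0 n] is the argument of [R_n]; [block n m] holds the next [m] parameters, which determine
    the second factor in the submultiplicative bound. *)
Definition block (k n : nat) (w : T) : n.-tuple E :=
  [tuple X (k + i)%N w | i < n].

Lemma measurable_block (k n : nat) : measurable_fun setT (block k n).
Proof.
apply/measurable_fun_tnthP => i.
rewrite (_ : _ \o _ = X (k + i)%N); first exact: measurable_funPT.
by apply/funext => w /=; rewrite tnth_mktuple.
Qed.

Lemma measurable_block_preimage (k n : nat) (A : set (n.-tuple E)) :
  measurable A -> measurable (block k n @^-1` A).
Proof.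
by move=> mA; rewrite -[X in measurable X]setTI; exact: measurable_block.
Qed.

(** Independence gives a product of marginals, and equality in law replaces each by the law of
    [X 0]; the value therefore does not depend on [k]. *)
Lemma block_rectangle (k n : nat) (F : nat -> set E) :
  (forall i, measurable (F i)) ->
  P (block k n @^-1` tuple_rectangle F) =
  (\prod_(0 <= i < n) distribution P (X 0%N) (F i))%E.
Proof.
move=> mF; have [indep ident] := iidX.
(* The block occupies the indices [k, ..., k + n - 1], so index [i] carries the side [F (i - k)]. *)
pose J : {fset nat} := [fset i in iota k n]%fset.
have JE i : (i \in J) = (k <= i < k + n)%N by rewrite inE/= mem_iota.
rewrite (_ : _ @^-1` _ =
    \bigcap_(i in [set` J]) (X i @^-1` F (i - k)%N)); last first.
  apply/seteqP; split=> w /=.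
    move=> Fw i; rewrite /= JE => /andP[ki ikn].
    have ikn' : (i - k < n)%N by rewrite ltn_subLR.
    by have := Fw (Ordinal ikn'); rewrite tnth_mktuple /= subnKC.
  move=> Fw i; rewrite tnth_mktuple.
  have := Fw (k + i)%N; rewrite /= JE leq_addr ltn_add2l ltn_ord addKn.
  exact.
rewrite indep//.
rewrite (perm_big (iota k n)); last first.
  apply: uniq_perm => [||i]; [exact: fset_uniq|exact: iota_uniq|].
  by rewrite JE mem_iota.
rewrite -[X in iota X]addn0 iotaDl big_map /index_iota subn0.
apply: eq_bigr => i _; rewrite addKn; exact: ident.
Qed.


HB.instance Definition _ (k n : nat) :=
  isMeasurableFun.Build _ _ _ _ (block k n) (@measurable_block k n).

Lemma block_stationary (k n : nat) (A : set (n.-tuple E)) : measurable A ->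
  P (block k n @^-1` A) = P (block 0 n @^-1` A).
Proof.
move=> mA.
apply: (tuple_measure_unique (m1 := pushforward P (block k n))
  (m2 := pushforward P (block 0 n)) _ _ mA) => [|F mF].
  by rewrite ltey_eq fin_num_measure //; exact: measurable_block_preimage.
exact: (etrans (block_rectangle k n mF) (esym (block_rectangle 0 n mF))).
Qed.

(** Adjacent blocks form one block of length [n + m]; joining the sides into [H] gives a single
    rectangle, whose product splits at [n]. Stationarity is included, since the last factor has
    shift 0. *)
Lemma block_independent_rectangles (n m : nat) (F G : nat -> set E) :
  (forall i, measurable (F i)) -> (forall i, measurable (G i)) ->
  P (block 0 n @^-1` tuple_rectangle F `&` block n m @^-1` tuple_rectangle G) =
  (P (block 0 n @^-1` tuple_rectangle F) *
   P (block 0 m @^-1` tuple_rectangle G))%E.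
Proof.
move=> mF mG.
pose H i := if (i < n)%N then F i else G (i - n)%N.
have mH i : measurable (H i) by rewrite /H; case: ifP.
rewrite (_ : _ `&` _ = block 0 (n + m) @^-1` tuple_rectangle H).
  rewrite !block_rectangle// (@big_cat_nat _ _ _ n)//= ?leq_addr//; congr *%E.
    by rewrite !big_mkord; apply: eq_bigr => i _; rewrite /H ltn_ord.
  rewrite -{1}(add0n n) big_addn addKn; apply: eq_bigr => i _.
  by rewrite /H ltnNge leq_addl addnK.
apply/seteqP; split=> w /=.
  move=> [Fw Gw] i; rewrite tnth_mktuple /H; case: ltnP => [ni|ni].
    by have := Fw (Ordinal ni); rewrite tnth_mktuple.
  have lim : (i - n < m)%N by rewrite ltn_subLR.
  by have := Gw (Ordinal lim); rewrite tnth_mktuple /= subnKC.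
move=> Hw; split=> i; rewrite tnth_mktuple.
  by have := Hw (lshift m i); rewrite tnth_mktuple /H /= ltn_ord.
have := Hw (rshift n i); rewrite tnth_mktuple /H /=.
by rewrite ltnNge leq_addr addKn.
Qed.

(** With one set fixed, both sides are finite measures in the other set, so uniqueness of measures
    extends the identity from rectangles one argument at a time. *)
Lemma block_independent (n m : nat) (A : set (n.-tuple E)) (C : set (m.-tuple E)) :
  measurable A -> measurable C ->
  P (block 0 n @^-1` A `&` block n m @^-1` C) =
  (P (block 0 n @^-1` A) * P (block 0 m @^-1` C))%E.
Proof.
(* [mscale] takes a nonnegative real factor, so probabilities are repackaged as such. *)
pose p D : {nonneg R} := NngNum (fine_ge0 (measure_ge0 P D)).
have pE D : measurable D -> (p D)%:num%:E = P D.
  by move=> mD; rewrite /= fineK // fin_num_measure.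
have fin (D : set T) : measurable D -> (P D < +oo)%E.
  by move=> mD; rewrite ltey_eq fin_num_measure.
have mB := @measurable_block_preimage.
(* First extension: the set for the first block stays a rectangle while [C] becomes arbitrary. *)
have rectl F : (forall i, measurable (F i)) -> measurable C ->
    P (block 0 n @^-1` tuple_rectangle F `&` block n m @^-1` C) =
    (P (block 0 n @^-1` tuple_rectangle F) * P (block 0 m @^-1` C))%E.
  move=> mF; have mrF := @measurable_tuple_rectangle _ _ n F mF.
  rewrite setIC -(pE _ (mB _ _ _ mrF)).
  move=> mC; apply: (tuple_measure_unique
    (m1 := pushforward (mrestr P (mB 0%N n _ mrF)) (block n m))
    (m2 := mscale (p (block 0 n @^-1` tuple_rectangle F))
      (pushforward P (block 0 m))) _ _ mC) => [|G mG].
    by apply: fin; apply: measurableI; [exact: mB|exact: mB].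
  change (P (block n m @^-1` tuple_rectangle G `&` block 0 n @^-1` tuple_rectangle F)
    = (p (block 0 n @^-1` tuple_rectangle F))%:num%:E *
      P (block 0 m @^-1` tuple_rectangle G))%E.
  by rewrite (pE _ (mB _ _ _ mrF)) setIC block_independent_rectangles.
(* Second extension: [C] is now fixed, and the rectangle is replaced by any measurable [A]. *)
move=> mA mC; rewrite muleC -(pE _ (mB _ _ _ mC)).
apply: (tuple_measure_unique
    (m1 := pushforward (mrestr P (mB n m _ mC)) (block 0 n))
    (m2 := mscale (p (block 0 m @^-1` C)) (pushforward P (block 0 n)))
    _ _ mA) => [|F mF].
  by apply: fin; apply: measurableI; [exact: mB|exact: mB].
change (P (block 0 n @^-1` tuple_rectangle F `&` block n m @^-1` C) =
  (p (block 0 m @^-1` C))%:num%:E * P (block 0 n @^-1` tuple_rectangle F))%E.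
by rewrite (pE _ (mB _ _ _ mC)) rectl // muleC.
Qed.

End IIDBlocks.

(** * Subadditive sequences and moments *)

(** The limit is the infimum of [a n / n] over [n >= 1], finite by the linear lower bound. An index
    [k] nearly attaining it controls all large [n] through division by [k]. *)
Lemma fekete (R : realType) (a : nat -> R) (L : R) :
  (forall m n, a (m + n)%N <= a m + a n) -> (forall n, n%:R * L <= a n) ->
  exists2 l : R, (n%:R^-1 * a n @[n --> \oo] --> l) &
    forall n, (0 < n)%N -> l <= n%:R^-1 * a n.
Proof.
move=> asub aL; pose u n : R := n%:R^-1 * a n.
pose U : set R := [set u n | n in [set n | (0 < n)%N]].
have Un n : (0 < n)%N -> U (u n) by move=> n0; exists n.
have lbU : lbound U L.
  by move=> _ [n n0 <-]; rewrite /u mulrC ler_pdivlMr ?ltr0n// mulrC.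
have hiU : has_inf U by split; [exists (u 1%N); exact: Un|exists L].
have infU n : (0 < n)%N -> inf U <= u n by move=> /Un; apply: ge_inf; exists L.
exists (inf U) => //; apply/cvgrPdist_le => e e0.
have e20 : 0 < e / 2 by rewrite divr_gt0.
have [_ [k k0 <-] uk] := inf_adherent e20 hiU.
(* Subtracting the linear term makes [b k = 0], so subadditivity gives
   [b (n + k) <= b n]. *)
pose b n := a n - n%:R * u k.
have bk n : b (n + k)%N <= b n.
  have kuk : k%:R * u k = a k by rewrite /u mulVKf// pnatr_eq0 -lt0n.
  by rewrite /b natrD mulrDl kuk; have := asub n k; lra.
(* Each [n] is a remainder below [k] plus a multiple of [k], and [b] does not increase along steps
   of [k]; hence [C] bounds [b] everywhere. *)
pose C := \sum_(r < k) `|b r|.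
have bC n : b n <= C.
  rewrite (divn_eq n k) addnC; elim: (n %/ k)%N => [|j IH].
    rewrite mul0n addn0 (le_trans (ler_norm _))//.
    by rewrite /C (bigD1 (Ordinal (ltn_pmod n k0)))//= lerDl sumr_ge0.
  by rewrite mulSn addnCA addnC; exact: le_trans (bk _) IH.
near=> n.
have n0 : (0 < n)%N by near: n; exists 1%N.
have nR : 0 < n%:R :> R by rewrite ltr0n.
(* After division by [n], [C] contributes at most [e / 2]; the other [e / 2] is the excess of [u k]
   over the infimum. *)
have Cn : C <= n%:R * (e / 2).
  rewrite -ler_pdivrMr//; near: n; exact: nbhs_infty_ger.
rewrite -/(u n) ler_distlC; apply/andP; split.
  by have := infU n n0; lra.
rewrite /u mulrC ler_pdivrMr//.
have -> : a n = b n + n%:R * u k by rewrite /b subrK.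
have := bC n; nra.
Unshelve. all: by end_near.
Qed.

(** * Expectations of finitely valued variables, and Markov's inequality *)

Section FiniteExpectation.
Context {dT : measure_display} {T : measurableType dT} {R : realType}.
Variable P : probability T R.

Lemma measurable_fun_nat (f : T -> nat) (g : nat -> R) :
  measurable_fun setT f -> measurable_fun setT (g \o f).
Proof. by move=> mf; apply: measurableT_comp. Qed.

(** [g \o Z] is the sum of the indicators of the fibres of [Z], weighted by [g]. *)
Lemma expectation_finite (I : finType) (Z : T -> I) (g : I -> R) :
  (forall i, measurable (Z @^-1` [set i])) -> (forall i, 0 <= g i) ->
  ('E_P[g \o Z] = (\sum_i g i * fine (P (Z @^-1` [set i])))%:E)%E.
Proof.
move=> mZ g0; rewrite unlock.
rewrite (_ : (fun w => ((g \o Z) w)%:E) =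
    (fun w => \sum_(i : I) (g i)%:E * (\1_(Z @^-1` [set i]) w)%:E)%E); last first.
  apply/funext => w /=; rewrite (bigD1 (Z w))//= indicE mem_set// mule1.
  rewrite big1 ?adde0// => i iZ; rewrite indicE memNset ?mule0//=.
  by move=> Zi; rewrite Zi eqxx in iZ.
rewrite ge0_integral_sum//=; last 2 first.
- move=> i; apply/measurable_EFinP; exact: measurable_funM.
- by move=> i w _; rewrite mule_ge0// lee_fin.
rewrite -sumEFin; apply: eq_bigr => i _.
rewrite ge0_integralZl_EFin//=; last first.
  by apply/measurable_EFinP; exact: measurable_indic.
by rewrite integral_indic// setIT EFinM fineK// fin_num_measure.
Qed.

Lemma expectation_bounded_nat (b : nat) (N : T -> nat) (g : nat -> R) :
  measurable_fun setT N -> (forall w, N w < b)%N -> (forall i, 0 <= g i) ->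
  ('E_P[g \o N] = (\sum_(i < b) g i * fine (P (N @^-1` [set nat_of_ord i])))%:E)%E.
Proof.
move=> mN Nb g0; pose Z w : 'I_b := Ordinal (Nb w).
have ZE i : Z @^-1` [set i] = N @^-1` [set nat_of_ord i].
  by apply/seteqP; split=> w /= [Zw]; [rewrite -Zw|exact/val_inj].
rewrite (_ : g \o N = (fun i : 'I_b => g i) \o Z)// expectation_finite//.
  by congr EFin; apply: eq_bigr => i _; rewrite ZE.
by move=> i; rewrite ZE -[X in measurable X]setTI; exact: mN.
Qed.

(** The factorisation hypothesis combines independence of [N] and [S] with equality in law of [S]
    and [S']. The pair [(N, S)] takes finitely many values, so the claim is a product of two finite
    sums. *)
Lemma expectation_independent_mul (b c : nat) (N S S' : T -> nat) (f g : nat -> R) :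
  measurable_fun setT N -> measurable_fun setT S -> measurable_fun setT S' ->
  (forall w, N w < b)%N -> (forall w, S w < c)%N -> (forall w, S' w < c)%N ->
  (forall i j, P (N @^-1` [set i] `&` S @^-1` [set j]) =
    (P (N @^-1` [set i]) * P (S' @^-1` [set j]))%E) ->
  (forall i, 0 <= f i) -> (forall i, 0 <= g i) ->
  ('E_P[fun w => (f (N w) * g (S w))%R] = 'E_P[f \o N] * 'E_P[g \o S'])%E.
Proof.
move=> mN mS mS' Nb Sc S'c ind f0 g0.
pose Z w : 'I_b * 'I_c := (Ordinal (Nb w), Ordinal (Sc w)).
have mfib (h : T -> nat) i : measurable_fun setT h -> measurable (h @^-1` [set i]).
  by move=> mh; rewrite -[X in measurable X]setTI; exact: mh.
have ZE i : Z @^-1` [set i] =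
    N @^-1` [set nat_of_ord i.1] `&` S @^-1` [set nat_of_ord i.2].
  case: i => i j; apply/seteqP; split=> w /=; first by move=> [<- <-].
  by move=> [Ni Sj]; congr pair; exact/val_inj.
rewrite (_ : (fun w => _) = (fun i : 'I_b * 'I_c => f i.1 * g i.2) \o Z)//.
rewrite expectation_finite//; last 2 first.
- by move=> i; rewrite ZE; apply: measurableI; exact: mfib.
- by move=> i; rewrite mulr_ge0.
rewrite (expectation_bounded_nat mN Nb f0) (expectation_bounded_nat mS' S'c g0).
rewrite -EFinM; congr EFin; rewrite big_distrlr pair_big /=.
apply: eq_bigr => i _; rewrite ZE ind fineM ?fin_num_measure//; last 2 first.
- exact: mfib.
- exact: mfib.
by rewrite mulrACA.
Qed.

(** Integration of [c * \1_A <= X]. The event is arbitrary, so upper and lower tails are both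
    covered. *)
Lemma markov_set (A : set T) (X : T -> R) (c : R) :
  measurable A -> measurable_fun setT X -> (forall w, 0 <= X w) -> 0 <= c ->
  (forall w, A w -> c <= X w) -> (c%:E * P A <= 'E_P[X])%E.
Proof.
move=> mA mX X0 c0 cX; rewrite unlock.
have -> : (c%:E * P A = \int[P]_w (c%:E * (\1_A w)%:E))%E.
  rewrite ge0_integralZl_EFin//=; last first.
    by apply/measurable_EFinP; exact: measurable_indic.
  by rewrite integral_indic// setIT.
apply: ge0_le_integral => //=.
- by move=> w _; rewrite mule_ge0// lee_fin.
- apply/measurable_EFinP; exact: measurable_funM.
- exact/measurable_EFinP.
- move=> w _; rewrite -EFinM lee_fin indicE.
  by have [/set_mem/cX|_] := boolP (w \in A); rewrite ?mulr1 ?mulr0.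
Qed.

End FiniteExpectation.

(** Tail suprema of [u] are eventually below those of [v]. The comparison starts at [n = 1], as
    normalisation by [n] requires. *)
Lemma limn_esup_le_cvgn (R : realType) (u v : (\bar R)^nat) (l : \bar R) :
  (forall n, (0 < n)%N -> (u n <= v n)%E) -> v @ \oo --> l ->
  (limn_esup u <= l)%E.
Proof.
move=> uv vl; rewrite limn_esup_lim -(cvg_lim _ (cvg_esups vl))//.
apply: lee_lim; [exact: is_cvg_esups|exact: is_cvg_esups|].
near=> n; apply/ereal_supP => _ [k /= nk <-].
apply: le_trans (uv k _) _.
  by apply: leq_trans nk; near: n; exists 1%N.
by apply: ereal_sup_ubound; exists k.
Unshelve. all: by end_near.
Qed.

(** * Moments of a submultiplicative process with independent blocks *)

Section SubmultiplicativeProcess.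
Context {dT : measure_display} {T : measurableType dT} {R : realType}.
Variables (P : probability T R) (N : nat -> T -> nat) (B : R).
Hypothesis mN : forall n, measurable_fun setT (N n).
Hypothesis N_gt0 : forall n w, (0 < N n w)%N.
Hypothesis N_le : forall n w, (N n w)%:R <= B ^+ n.
(** [S] stands for the complexity of the shifted block; the last clause says both that it is
    independent of [N n] and that it has the law of [N m]. *)
Hypothesis N_submul : forall n m, exists S : T -> nat,
  [/\ measurable_fun setT S,
      forall w, (0 < S w)%N,
      forall w, (S w)%:R <= B ^+ m,
      forall w, (N (n + m) w <= N n w * S w)%N &
      forall i j, P (N n @^-1` [set i] `&` S @^-1` [set j]) =
        (P (N n @^-1` [set i]) * P (N m @^-1` [set j]))%E].

Definition moment (q : R) (n : nat) : R :=
  fine ('E_P[fun w => ((N n w)%:R `^ q)%R])%E.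

(** At any point of the inhabited space [T], [1 <= N 1 <= B]. *)
Let B_ge1 : 1 <= B.
Proof.
by apply: le_trans (N_le 1%N point); rewrite ler1n.
Qed.

Let measurable_powN (q : R) (n : nat) :
  measurable_fun setT (fun w => (N n w)%:R `^ q : R).
Proof. exact: (measurable_fun_nat (fun k => k%:R `^ q) (mN n)). Qed.

Let powN_bounds (q : R) (n : nat) w :
  expR (n%:R * Num.min 0 (q * ln B)) <= (N n w)%:R `^ q <=
  expR (n%:R * Num.max 0 (q * ln B)).
Proof.
have NR : 0 < (N n w)%:R :> R by rewrite ltr0n.
have B0 : 0 < B by exact: lt_le_trans B_ge1.
have lN0 : 0 <= ln (N n w)%:R :> R by rewrite ln_ge0// ler1n.
have lNB : ln (N n w)%:R <= n%:R * ln B.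
  by rewrite mulr_natl -lnXn// ler_ln ?posrE ?exprn_gt0.
have -> : (N n w)%:R `^ q = expR (q * ln (N n w)%:R).
  by rewrite /powR gt_eqF.
rewrite !ler_expR; have [q0|/ltW q0] := leP 0 q.
  rewrite (min_idPl _) ?(max_idPr _) ?mulr_ge0 ?ln_ge0// mulr0 mulr_ge0//=.
  by rewrite mulrCA ler_wpM2l.
rewrite (min_idPr _) ?(max_idPl _) ?mulr_le0_ge0 ?ln_ge0// mulr0.
by rewrite mulrCA ler_wnM2l//= mulr_le0_ge0.
Qed.

(** An integer bound makes the variables finitely valued, so every moment becomes a finite sum. *)
Let lt_bound (U : T -> nat) (n : nat) : (forall w, (U w)%:R <= B ^+ n) ->
  forall w, (U w < Num.bound (B ^+ n))%N.
Proof.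
move=> UB w; rewrite -(ltr_nat R); apply: le_lt_trans (UB w) _.
by apply: archi_boundP; rewrite exprn_ge0// (le_trans _ B_ge1).
Qed.

Lemma expectation_moment (q : R) (n : nat) :
  ('E_P[fun w => ((N n w)%:R `^ q)%R] = (moment q n)%:E)%E.
Proof.
by rewrite /moment (expectation_bounded_nat P (mN n) (lt_bound (N_le n))
  (g := fun k => k%:R `^ q)).
Qed.

Lemma moment_bounds (q : R) (n : nat) :
  expR (n%:R * Num.min 0 (q * ln B)) <= moment q n <=
  expR (n%:R * Num.max 0 (q * ln B)).
Proof.
have b := powN_bounds q n.
rewrite -!lee_fin -expectation_moment -!(expectation_cst P).
apply/andP; split; apply: expectation_le => [||w|w|].
- exact: measurable_cst.
- exact: measurable_powN.
- exact: expR_ge0.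
- exact: powR_ge0.
- by apply: aeW => w; have /andP[] := b w.
- exact: measurable_powN.
- exact: measurable_cst.
- exact: powR_ge0.
- exact: expR_ge0.
- by apply: aeW => w; have /andP[] := b w.
Qed.

Lemma moment_gt0 (q : R) (n : nat) : 0 < moment q n.
Proof. by have /andP[+ _] := moment_bounds q n; apply: lt_le_trans; rewrite expR_gt0. Qed.

Lemma ln_moment_bounds (q : R) (n : nat) :
  n%:R * Num.min 0 (q * ln B) <= ln (moment q n) <= n%:R * Num.max 0 (q * ln B).
Proof.
have /andP[lo hi] := moment_bounds q n.
rewrite -[_ * Num.min _ _]expRK -[_ * Num.max _ _]expRK.
by rewrite !ler_ln ?posrE ?expR_gt0 ?moment_gt0// lo.
Qed.

Lemma moment_block (q : R) (n m : nat) (S : T -> nat) :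
  measurable_fun setT S -> (forall w, (S w)%:R <= B ^+ m) ->
  (forall i j, P (N n @^-1` [set i] `&` S @^-1` [set j]) =
    (P (N n @^-1` [set i]) * P (N m @^-1` [set j]))%E) ->
  ('E_P[fun w => ((N n w)%:R `^ q * (S w)%:R `^ q)%R] = (moment q n * moment q m)%:E)%E.
Proof.
move=> mS SB ind.
have p0 i : 0 <= i%:R `^ q :> R by exact: powR_ge0.
have := expectation_independent_mul (mN n) mS (mN m) (lt_bound (N_le n))
  (lt_bound SB) (lt_bound (N_le m)) ind p0 p0.
by rewrite EFinM -!expectation_moment => <-.
Qed.

Lemma moment_submul (q : R) (n m : nat) : 0 <= q ->
  moment q (n + m) <= moment q n * moment q m.
Proof.
move=> q0; have [S [mS S0 SB NS ind]] := N_submul n m.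
rewrite -lee_fin -expectation_moment -(moment_block q mS SB ind).
apply: expectation_le => [||w|w|].
- exact: measurable_powN.
- apply: measurable_funM; first exact: measurable_powN.
  exact: (measurable_fun_nat (fun k => k%:R `^ q) mS).
- exact: powR_ge0.
- by rewrite mulr_ge0 ?powR_ge0.
- apply: aeW => w; rewrite -powRM// -natrM.
  by rewrite ge0_ler_powR// ?nnegrE ?ler0n// ler_nat.
Qed.

(** For [q <= 0] the power is decreasing on positive numbers, so the submultiplicative bound is
    reversed. *)
Lemma moment_supermul (q : R) (n m : nat) : q <= 0 ->
  moment q n * moment q m <= moment q (n + m).
Proof.
move=> q0; have [S [mS S0 SB NS ind]] := N_submul n m.
rewrite -lee_fin -expectation_moment -(moment_block q mS SB ind).
apply: expectation_le => [||w|w|].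
- apply: measurable_funM; first exact: measurable_powN.
  exact: (measurable_fun_nat (fun k => k%:R `^ q) mS).
- exact: measurable_powN.
- by rewrite mulr_ge0 ?powR_ge0.
- exact: powR_ge0.
- apply: aeW => w; rewrite -powRM// -natrM.
  have NSw : 0 < (N n w * S w)%N%:R :> R by rewrite ltr0n muln_gt0 N_gt0 S0.
  have NN : 0 < (N (n + m) w)%:R :> R by rewrite ltr0n.
  by rewrite /powR !gt_eqF// ler_expR ler_wnM2l// ler_ln// ler_nat.
Qed.

(* Hölder's inequality, by applying the convexity of [expR] pointwise to the
   powers normalised by their expectations. *)
Lemma ln_moment_convex (t : {i01 R}) (q1 q2 : R) (n : nat) :
  ln (moment (t%:num * q1 + (1 - t%:num) * q2) n) <=
  t%:num * ln (moment q1 n) + (1 - t%:num) * ln (moment q2 n).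
Proof.
set q := t%:num * q1 + _; set l := (X in _ <= X).
(* The weights are chosen so that the majorant [g] of the [q]-th power has expectation exactly
   [expR l]: each normalised power has mean 1, and the weights [t] and [1 - t] sum to 1. *)
pose c1 := t%:num / moment q1 n; pose c2 := (1 - t%:num) / moment q2 n.
have c1_ge0 : 0 <= c1 by rewrite divr_ge0// ltW// moment_gt0.
have c2_ge0 : 0 <= c2 by rewrite divr_ge0 ?subr_ge0// ltW// moment_gt0.
pose g k : R := expR l * (c1 * k%:R `^ q1 + c2 * k%:R `^ q2).
have g_ge0 k : 0 <= g k by rewrite mulr_ge0 ?expR_ge0// addr_ge0// mulr_ge0 ?powR_ge0.
have expRB_ln r a L : 0 < a -> expR (r * L - ln a) = expR (r * L) / a.
  by move=> a0; rewrite expRD expRN lnK.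
have powg w : (N n w)%:R `^ q <= g (N n w).
  have NR : 0 < (N n w)%:R :> R by rewrite ltr0n.
  have powE (r : R) : (N n w)%:R `^ r = expR (r * ln (N n w)%:R) by rewrite /powR gt_eqF.
  rewrite /g !powE; set L := ln (N n w)%:R.
  have := convex_expR t (q1 * L - ln (moment q1 n)) (q2 * L - ln (moment q2 n)).
  rewrite !convRE /unstable.onem !expRB_ln ?moment_gt0// => h.
  (* The difference [q * L - l] is the convex combination of the two normalised exponents. *)
  rewrite -[q * L](subrKC l) expRD ler_pM2l ?expR_gt0//.
  apply: le_trans (le_trans h _); last by rewrite /c1 /c2; lra.
  by rewrite ler_expR /q /l; lra.
have Eg : ('E_P[g \o N n] = (expR l)%:E)%E.
  rewrite (expectation_bounded_nat P (mN n) (lt_bound (N_le n)) g_ge0).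
  have momentE r : moment r n = \sum_(i < Num.bound (B ^+ n))
      i%:R `^ r * fine (P (N n @^-1` [set nat_of_ord i])).
    by rewrite /moment (expectation_bounded_nat P (mN n) (lt_bound (N_le n))
      (g := fun k => k%:R `^ r)).
  congr EFin; transitivity (expR l * (c1 * moment q1 n + c2 * moment q2 n)).
    rewrite !momentE !mulr_sumr -big_split /= mulr_sumr.
    by apply: eq_bigr => i _; rewrite /g; ring.
  by rewrite /c1 /c2 !mulfVK ?gt_eqF ?moment_gt0// subrKC mulr1.
rewrite -ler_expR lnK ?posrE ?moment_gt0//.
rewrite -lee_fin -expectation_moment -Eg.
apply: expectation_le => [||w|w|].
- exact: measurable_powN.
- exact: measurable_fun_nat.
- exact: powR_ge0.
- exact: g_ge0.
- exact: aeW.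
Qed.

(** Markov's inequality for the [q]-th power at level [expR (n * q * x)]. Stating the hypothesis
    after multiplication by [q] lets either sign of [q] be used. *)
Lemma chernoff_moment (q x : R) (n : nat) (A : set T) : (0 < n)%N ->
  measurable A ->
  (forall w, A w -> q * x <= q * (n%:R^-1 * ln (N n w)%:R)) ->
  ((n%:R^-1)%:E * lne (P A) <= (n%:R^-1 * ln (moment q n) - q * x)%:E)%E.
Proof.
move=> n0 mA Ax; have nR : 0 < n%:R :> R by rewrite ltr0n.
have : ((expR (n%:R * (q * x)))%:E * P A <= (moment q n)%:E)%E.
  rewrite -expectation_moment; apply: markov_set => [//||w||w /Ax qxw].
  - exact: measurable_powN.
  - exact: powR_ge0.
  - exact: expR_ge0.
  - rewrite /powR gt_eqF ?ltr0n// ler_expR.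
    by rewrite (le_trans (ler_wpM2l (ltW nR) qxw))// mulrCA mulVKf// gt_eqF.
have -> : (P A = (fine (P A))%:E)%E by rewrite fineK// fin_num_measure.
move: (fine (P A)) => p; rewrite -EFinM lee_fin => markov.
(* A null event has logarithm [-oo], and the bound is then trivial. *)
rewrite /lne; have [p_le0|p_gt0] := leP p 0.
  by rewrite gt0_muleNy ?lte_fin ?invr_gt0// leNye.
rewrite -EFinM lee_fin -(ler_pM2l nR) mulrBr !mulVKf ?gt_eqF//.
rewrite lerBrDr addrC -[X in X + _]expRK -lnM ?posrE ?expR_gt0//.
by rewrite ler_ln ?posrE ?mulr_gt0 ?expR_gt0 ?moment_gt0.
Qed.

(** Fekete's lemma applies to the log-moments when [q >= 0] and to their negatives when [q < 0]; the
    moment bounds supply the linear lower bound. *)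
Lemma ln_moment_cvg (q : R) : exists l : R,
  [/\ n%:R^-1 * ln (moment q n) @[n --> \oo] --> l,
      0 <= q -> forall n, (0 < n)%N -> l <= n%:R^-1 * ln (moment q n) &
      q < 0 -> forall n, (0 < n)%N -> n%:R^-1 * ln (moment q n) <= l].
Proof.
have bounds := ln_moment_bounds q.
have [q0|q0] := leP 0 q.
  have [||l ul lu] := @fekete _ (fun n => ln (moment q n)) (Num.min 0 (q * ln B)).
  - move=> m n; rewrite -lnM ?posrE ?moment_gt0//.
    by rewrite ler_ln ?posrE ?mulr_gt0 ?moment_gt0// moment_submul.
  - by move=> n; have /andP[] := bounds n.
  by exists l; split.
have [||l ul lu] :=
  @fekete _ (fun n => - ln (moment q n)) (- Num.max 0 (q * ln B)).
- move=> m n; rewrite -opprD lerN2 -lnM ?posrE ?moment_gt0//.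
  by rewrite ler_ln ?posrE ?mulr_gt0 ?moment_gt0// moment_supermul// ltW.
- by move=> n; rewrite mulrN lerN2; have /andP[] := bounds n.
exists (- l); split=> // [|_ n n0].
  rewrite [X in X @ _](_ : _ = fun n => - (n%:R^-1 * - ln (moment q n))).
    exact: cvgN.
  by apply/funext => n; rewrite mulrN opprK.
by rewrite lerNr -mulrN lu.
Qed.

End SubmultiplicativeProcess.

(** * The random composition *)

(** As sequences, consecutive blocks concatenate by splitting [iota], with no casts between tuple
    lengths. *)
Lemma block_seq {dT dE : measure_display} {T : measurableType dT}
    {E : measurableType dE} {R : realType} {P : probability T R}
    (X : nat -> {RV P >-> E}) (k n : nat) (w : T) :
  block X k n w = [seq X j w | j <- iota k n] :> seq E.
Proof.
apply: (@eq_from_nth _ point) => [|i]; rewrite size_tuple ?size_map ?size_iota//.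
move=> i_n; rewrite (nth_map 0%N) ?size_iota// nth_iota//.
by rewrite -[i in LHS]/(nat_of_ord (Ordinal i_n)) -tnth_nth tnth_mktuple.
Qed.

Section RandomPiecewiseAffine.
Context {R : realType} {d : nat} {K : set 'rV[R]_d}.
Context {dE : measure_display} {E : measurableType dE}.
Context {Phi : E -> 'rV[R]_d -> 'rV[R]_d}.
Context {dT : measure_display} {T : measurableType dT} {P : probability T R}.
Variables (omega : nat -> {RV P >-> E}) (B : R).
Hypothesis polyK : compact_convex_polytope K.
Hypothesis PhiP : forall e, piecewise_affine K (Phi e).
Hypothesis iid_omega : iid omega.
Hypothesis mRparam : forall n, (1 <= n)%N ->
  measurable_fun [set: n.-tuple E] (@Rparam R d dE E K Phi n).
Hypothesis B_ge1 : 1 <= B.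
Hypothesis Rcov_le : forall e, (Rcov K (Phi e))%:R <= B.

(** There is only one empty tuple, so [Rparam] is constant for [n = 0]. *)
Let mRparam0 n : measurable_fun [set: n.-tuple E] (@Rparam R d dE E K Phi n).
Proof.
case: n => [|n]; last exact: mRparam.
rewrite (_ : @Rparam _ _ _ _ _ _ _ = cst (Rparam K Phi [tuple])).
  exact: measurable_cst.
by apply/funext => s; rewrite tuple0.
Qed.

Lemma RnE (n : nat) : Rn K Phi omega n = @Rparam _ _ _ _ K Phi n \o block omega 0 n.
Proof. by []. Qed.

Let measurable_Rparam_block k n :
  measurable_fun setT (@Rparam _ _ _ _ K Phi n \o block omega k n).
Proof. by apply: measurableT_comp; [exact: mRparam0|exact: measurable_block]. Qed.

Lemma measurable_Rn n : measurable_fun setT (Rn K Phi omega n).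
Proof. by rewrite RnE. Qed.

Lemma Rn_gt0 n w : (0 < Rn K Phi omega n w)%N.
Proof. exact: Rcov_compose_params_gt0. Qed.

Lemma Rn_le n w : (Rn K Phi omega n w)%:R <= B ^+ n.
Proof.
rewrite -[n in B ^+ n](size_tuple [tuple omega i w | i < n]).
exact: Rcov_compose_params_le.
Qed.

Lemma Rn_submul n m : exists S : T -> nat,
  [/\ measurable_fun setT S,
      forall w, (0 < S w)%N,
      forall w, (S w)%:R <= B ^+ m,
      forall w, (Rn K Phi omega (n + m) w <= Rn K Phi omega n w * S w)%N &
      forall i j, P (Rn K Phi omega n @^-1` [set i] `&` S @^-1` [set j]) =
        (P (Rn K Phi omega n @^-1` [set i]) * P (Rn K Phi omega m @^-1` [set j]))%E].
Proof.
(* The witness is the complexity of the [m] parameters following the first [n]. *)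
exists (@Rparam _ _ _ _ K Phi m \o block omega n m); split => [|w|w|w|i j].
- exact: measurable_Rparam_block.
- exact: Rcov_compose_params_gt0.
- rewrite -[m in B ^+ m](size_tuple (block omega n m w)).
  exact: Rcov_compose_params_le.
- rewrite !RnE /Rparam /= !block_seq iotaD map_cat add0n.
  exact: Rcov_compose_params_cat.
- have mfib k u : measurable (@Rparam _ _ _ _ K Phi k @^-1` [set u]).
    by rewrite -[X in measurable X]setTI; exact: mRparam0.
  exact: (block_independent iid_omega (mfib n i) (mfib m j)).
Qed.

Lemma log_momentE q n : log_moment K Phi omega q n =
  (n%:R^-1 * ln (moment P (Rn K Phi omega) q n))%:E.
Proof.
rewrite /log_moment (expectation_moment P measurable_Rn Rn_gt0 Rn_le).
by rewrite lne_EFin ?(moment_gt0 P measurable_Rn Rn_gt0 Rn_le).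
Qed.

Lemma log_moment_cvg (q : R) : exists l : R,
  [/\ log_moment K Phi omega q @ \oo --> l%:E,
      0 <= q -> forall n, (0 < n)%N -> (l%:E <= log_moment K Phi omega q n)%E &
      q < 0 -> forall n, (0 < n)%N -> (log_moment K Phi omega q n <= l%:E)%E].
Proof.
have [l [ul lu ul']] := ln_moment_cvg measurable_Rn Rn_gt0 Rn_le Rn_submul q.
exists l; split=> [|q0 n n0|q0 n n0]; last 2 first.
- by rewrite log_momentE lee_fin lu.
- by rewrite log_momentE lee_fin ul'.
rewrite (_ : log_moment K Phi omega q =
  EFin \o (fun n => n%:R^-1 * ln (moment P (Rn K Phi omega) q n))).
  by apply/fine_cvgP; split; [exact: nearW|exact: ul].
by apply/funext => n; rewrite log_momentE.
Qed.

End RandomPiecewiseAffine.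

(** * Limit, variational formulas, convexity and tail bounds *)

Unset Implicit Arguments.

Theorem theorem2p2 (R : realType) (d : nat) (K : set 'rV[R]_d)
    (dE : measure_display) (E : measurableType dE)
    (Phi : E -> 'rV[R]_d -> 'rV[R]_d)
    (dT : measure_display) (T : measurableType dT) (P : probability T R)
    (omega : nat -> {RV P >-> E}) (B : R)
    (hK : compact_convex_polytope K)
    (hPhi : forall e, piecewise_affine K (Phi e))
    (hiid : iid omega)
    (hmeas : forall n, (1 <= n)%N ->
      measurable_fun [set: n.-tuple E] (@Rparam R d dE E K Phi n))
    (hB1 : 1 <= B)
    (hB : (ereal_sup [set ((Rcov K (Phi e))%:R : R)%:E | e in [set: E]] <= B%:E)%E) :
  [/\ forall q : R, cvgn (log_moment K Phi omega q),
      forall q : R, 0 <= q -> Lambda_cov K Phi omega q =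
        ereal_inf [set log_moment K Phi omega q n | n in [set n | (1 <= n)%N]],
      forall q : R, q < 0 -> Lambda_cov K Phi omega q =
        ereal_sup [set log_moment K Phi omega q n | n in [set n | (1 <= n)%N]] &
      [/\ forall q : R, Lambda_cov K Phi omega q \is a fin_num,
          convex_function [set: R^o] (fun q => fine (Lambda_cov K Phi omega q)),
          forall q : R,
            ((Num.min 0 (q * ln B))%:E <= Lambda_cov K Phi omega q
             <= (Num.max 0 (q * ln B))%:E)%E &
          forall x : R,
            (limn_esup (fun n => (n%:R^-1)%:E *
               lne (P [set w | (x <= Yn K Phi omega n w)%R]))
             <= - I_cov_plus K Phi omega x)%E /\
            (limn_esup (fun n => (n%:R^-1)%:E *
               lne (P [set w | (Yn K Phi omega n w <= x)%R]))
             <= - I_cov_minus K Phi omega x)%E]].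
Proof.
have Rcov_le e : (Rcov K (Phi e))%:R <= B.
  by rewrite -lee_fin; apply: le_trans hB; apply: ereal_sup_ubound; exists e.
have N_gt0 := Rn_gt0 omega hK hPhi.
have N_le := Rn_le omega hK hPhi hB1 Rcov_le.
have mN := measurable_Rn omega hmeas.
have lmE := log_momentE omega hK hPhi hmeas hB1 Rcov_le.
(* The real limits are collected into one function of [q], the real form of [Lambda_cov]. *)
have [l lP] := choice (log_moment_cvg hK hPhi hiid hmeas hB1 Rcov_le).
have LE q : Lambda_cov K Phi omega q = (l q)%:E.
  by have [+ _ _] := lP q; apply: cvg_lim.
have ucvg q : (n%:R^-1 * ln (moment P (Rn K Phi omega) q n)) @[n --> \oo] --> l q.
  have [+ _ _] := lP q.
  rewrite (_ : log_moment K Phi omega q =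
    EFin \o (fun n => n%:R^-1 * ln (moment P (Rn K Phi omega) q n))); last first.
    by apply/funext => n; rewrite lmE.
  by move/fine_cvgP => [].
have bounds q n : (0 < n)%N ->
    Num.min 0 (q * ln B) <= n%:R^-1 * ln (moment P (Rn K Phi omega) q n) <=
    Num.max 0 (q * ln B).
  move=> n0; have nR : 0 < n%:R :> R by rewrite ltr0n.
  by rewrite ler_pdivlMl// ler_pdivrMl// (ln_moment_bounds P mN N_gt0 N_le).
(* For one fixed [q] this bounds both kinds of tail; the rate functions arise by optimising over
   [q]. *)
have tail q x (A : nat -> set T) : (forall n, measurable (A n)) ->
    (forall n w, A n w -> q * x <= q * Yn K Phi omega n w) ->
    (limn_esup (fun n => (n%:R^-1)%:E * lne (P (A n))) <= (l q)%:E - (q * x)%:E)%E.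
  move=> mA Ax; apply: (@limn_esup_le_cvgn _ _
      (fun n => (n%:R^-1 * ln (moment P (Rn K Phi omega) q n) - q * x)%:E)).
    move=> n n0; apply: (chernoff_moment P mN N_gt0 N_le n0 (mA n)) => w.
    exact: Ax.
  by apply/fine_cvgP; split; [exact: nearW|apply: cvgB => //; exact: cvg_cst].
have mY x n : measurable [set w | (x <= Yn K Phi omega n w)%R] /\
    measurable [set w | (Yn K Phi omega n w <= x)%R].
  have mYn : measurable_fun setT (Yn K Phi omega n).
    exact: (measurable_fun_nat (fun k => n%:R^-1 * ln k%:R) (mN n)).
  split.
    rewrite (_ : [set w | _] = setT `&` Yn K Phi omega n @^-1` `[x, +oo[).
      exact: mYn.
    by apply/seteqP; split=> w /=; rewrite in_itv/= andbT; [split|case].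
  rewrite (_ : [set w | _] = setT `&` Yn K Phi omega n @^-1` `]-oo, x]).
    exact: mYn.
  by apply/seteqP; split=> w /=; rewrite in_itv/=; [split|case].
split; first by move=> q; apply/cvg_ex; exists (l q)%:E; have [] := lP q.
- move=> q q0; have [lm lm_ge _] := lP q; rewrite LE; apply/le_anti/andP; split.
    by apply/ereal_infP => _ [n n0 <-]; exact: lm_ge.
  (* The infimum lies below every term of index at least 1, hence below the limit. *)
  rewrite -(cvg_lim _ lm)//; apply: lime_ge; first by apply: cvgP lm.
  by exists 1%N => // n /= n0; apply: ereal_inf_lbound; exists n.
- move=> q q0; have [lm _ lm_le] := lP q; rewrite LE; apply/le_anti/andP; split.
    rewrite -(cvg_lim _ lm)//; apply: lime_le; first by apply: cvgP lm.
    by exists 1%N => // n /= n0; apply: ereal_sup_ubound; exists n.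
  by apply/ereal_supP => _ [n n0 <-]; exact: lm_le.
split=> [q|t q1 q2 _ _|q|x].
- by rewrite LE.
- rewrite !LE /= !convRE /unstable.onem.
  have cvgt : t%:num * (n%:R^-1 * ln (moment P (Rn K Phi omega) q1 n)) +
      (1 - t%:num) * (n%:R^-1 * ln (moment P (Rn K Phi omega) q2 n))
      @[n --> \oo] --> t%:num * l q1 + (1 - t%:num) * l q2.
    by apply: cvgD; apply: cvgM => //; exact: cvg_cst.
  (* Convexity at each [n], scaled by [1 / n], passes to the limit. *)
  apply: (ler_cvg_to (ucvg _) cvgt); apply: nearW => n.
  rewrite mulrCA (mulrCA (1 - _)) -mulrDr ler_wpM2l ?invr_ge0//.
  exact: (ln_moment_convex P mN N_gt0 N_le).
- rewrite LE !lee_fin; have lim := ucvg q.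
  apply/andP; split.
    apply: (ler_cvg_to (cvg_cst _) lim).
    by exists 1%N => // n /= /(bounds q)/andP[].
  apply: (ler_cvg_to lim (cvg_cst _)).
  by exists 1%N => // n /= /(bounds q)/andP[].
(* Negation reduces the supremum to each single [q]; for [q >= 0], [x <= Y_n] yields
   [q x <= q Y_n]. *)
- split; rewrite leeNr; apply/ereal_supP => _ [q /= q0 <-]; rewrite LE leeNr.
    apply: le_trans (tail q x _ _ _) _ => [n|n w /= xY|].
    + by have [] := mY x n.
    + exact: ler_wpM2l.
    + by rewrite oppeB// addeC.
  (* For [q <= 0] multiplication reverses [Y_n <= x], again giving [q x <= q Y_n]. *)
  apply: le_trans (tail q x _ _ _) _ => [n|n w /= xY|].
  + by have [] := mY x n.
  + exact: ler_wnM2l.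
  + by rewrite oppeB// addeC.
Qed.
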